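(* Let $\mathcal{S} = (\mathcal{Q}\times\mathcal{X}, \mathcal{V}\times\mathcal{U}, \rightsquigarrow)$ be a deterministic discrete-time control hybrid system with cost function $c$, let $k\in\mathbb{N}$, and let $Q$ be a Bellman-like Q-function for $\mathcal{S}$ with cost function $c$, given by its values on input sequences of length $k$. Let $Q'$ be a real-valued function of states and input sequences of length $k$ such that $$Q'\big((q,x),((v_i)_{i=1}^k,(u_i)_{i=1}^k)\big) \le \mathcal{T}_cQ\big((q,x),((v_i)_{i=1}^k,(u_i)_{i=1}^k)\big)$$ for all $q\in\mathcal{Q}$, $x\in\mathcal{X}$, $(v_i)_{i=1}^k\in\mathcal{V}^k$, $(u_i)_{i=1}^k\in\mathcal{U}^k$. Then $\max(Q,Q')$ is a Bellman-like Q-function for $\mathcal{S}$ with cost function $c$, where $\max(Q,Q')$ denotes the Q-function with cost function $c$ whose values on input sequences of length $k$ are the pointwise maximum of $Q$ and $Q'$.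
   Context: A discrete-time control hybrid system is a triple $\mathcal{S} = (\mathcal{Q}\times\mathcal{X}, \mathcal{V}\times\mathcal{U},\rightsquigarrow)$ where $\mathcal{Q}$ is a finite set of discrete states, $\mathcal{X}\subseteq\mathbb{R}^{n_x}$ the continuous state space, $\mathcal{V}$ a finite set of discrete inputs, $\mathcal{U}\subseteq\mathbb{R}^{n_u}$ the set of continuous inputs, and $\rightsquigarrow$ a set of transitions $((q,x),(v,u),(q',x'))$. $\mathrm{Post}_{(v,u)}(q,x)$ is the set of $(q',x')$ with $((q,x),(v,u),(q',x'))\in\ \rightsquigarrow$; the system is deterministic if every such set is empty or a singleton. A cost function is a real-valued function $c$ of $((q,x),(v,u))$. A Q-function with cost function $c$ given by its values on input sequences of length $k$ is a real-valued function $Q((q,x),((v_1,\ldots,v_k),(u_1,\ldots,u_k)))$, extended to all lengths $l>k$ by $$Q\big((q,x),((v_1,\ldots,v_l),(u_1,\ldots,u_l))\big) = c((q,x),(v_1,u_1)) + \max_{(q',x')\in\mathrm{Post}_{(v_1,u_1)}(q,x)} Q\big((q',x'),((v_2,\ldots,v_l),(u_2,\ldots,u_l))\big).$$ It is a Bellman-like Q-function of $\mathcal{S}$ with cost function $c$ if $Q((q,x),((v_i)_{i=1}^m,(u_i)_{i=1}^m)) \le Q((q,x),((v_i)_{i=1}^l,(u_i)_{i=1}^l))$ for all lengths $k\le m\le l$ (those for which $Q$ is defined), all states $(q,x)$ and all input sequences of length $l$. The Bellman operator on Q-functions is $$\mathcal{T}_cQ\big((q,x),((v_1,\ldots,v_k),(u_1,\ldots,u_k))\big)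 = \min_{v'\in\mathcal{V},\,u'\in\mathcal{U}} Q\big((q,x),((v_1,\ldots,v_k,v'),(u_1,\ldots,u_k,u'))\big).$$ Conventions: min and max over inputs or states are read as infimum and supremum in the extended reals, and the max over an empty Post set is $+\infty$ (an input that is not enabled has infinite cost). *)

(* Defs.v *)
From HB Require Import structures.
From mathcomp Require Import all_boot all_order all_algebra.
From mathcomp Require Import all_classical all_reals all_analysis.

Set Implicit Arguments.
Unset Strict Implicit.
Unset Printing Implicit Defensive.

Import Order.TTheory GRing.Theory Num.Theory.

Local Open Scope classical_set_scope.
Local Open Scope ring_scope.
Local Open Scope ereal_scope.

(* The sets X and U are used as types through the coercion of a set to the
   subtype of its elements, so that states and inputs range exactly over
   Q x X and V x U. *)
Record hybrid_system (R : realType) (nx nu : nat) := HybridSystem {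
  dstate : finType;
  cstate : set 'rV[R]_nx;
  dinput : finType;
  cinput : set 'rV[R]_nu;
  transitions :
    set ((dstate * cstate) * (dinput * cinput) * (dstate * cstate))
}.

Section HybridSystem.
Context {R : realType} {nx nu : nat} (S : hybrid_system R nx nu).

Definition state : Type := (dstate S * cstate S)%type.
Definition input : Type := (dinput S * cinput S)%type.

Definition post (a : input) (s : state) : set state :=
  [set s' | transitions (s, a, s')].

Definition deterministic : Prop :=
  forall (a : input) (s : state),
    post a s = set0 \/ exists s', post a s = [set s'].

Definition cost_function : Type := state -> input -> R.

Definition qfunction (k : nat) : Type :=
  state -> k.-tuple (dinput S) -> k.-tuple (cinput S) -> R.

(* ereal_sup set0 is -oo, whereas the max over an empty Post set is +oo. *)
Definition post_max (a : input) (s : state) (f : state -> \bar R) : \bar R :=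
  if post a s == set0 then +oo else ereal_sup [set f s' | s' in post a s].

(* The extension of Q to input sequences of length l >= k, written l = j + k
   so that the first j inputs are peeled off by recursion on j. *)
Fixpoint qext (c : cost_function) (k : nat) (Q : qfunction k) (j : nat) :
    state -> (j + k).-tuple (dinput S) -> (j + k).-tuple (cinput S) ->
    \bar R :=
  match j with
  | 0%N => fun s v u => (Q s v u)%:E
  | j'.+1 => fun s v u =>
      (c s (thead v, thead u))%:E +
      post_max (thead v, thead u) s
        (fun s' => qext c Q (j := j') s' (behead_tuple v) (behead_tuple u))
  end.
Arguments qext c {k} Q j s v u.

Definition tuple_prefix (T : Type) (m l : nat) (ml : (m <= l)%N)
    (t : l.-tuple T) : m.-tuple T :=
  [tuple tnth t (widen_ord ml i) | i < m].

Definition bellman_like (c : cost_function) (k : nat) (Q : qfunction k) :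
    Prop :=
  forall (i j : nat) (ml : (i + k <= j + k)%N) (s : state)
    (v : (j + k).-tuple (dinput S)) (u : (j + k).-tuple (cinput S)),
    qext c Q i s (tuple_prefix ml v) (tuple_prefix ml u) <= qext c Q j s v u.

Definition bellman_op (c : cost_function) (k : nat) (Q : qfunction k)
    (s : state) (v : k.-tuple (dinput S)) (u : k.-tuple (cinput S)) :
    \bar R :=
  ereal_inf [set qext c Q 1 s (rcons_tuple v a.1) (rcons_tuple u a.2)
            | a in [set: input]].

Definition qmax (k : nat) (Q Q' : qfunction k) : qfunction k :=
  fun s v u => Num.max (Q s v u) (Q' s v u).

End HybridSystem.

Arguments qext {R nx nu S} c {k} Q j s v u.

(* Main.v *)
(** The Bellman-like inequality for all pairs of lengths follows from its
    instance for lengths [k] and [k + 1], because the extension step is monotone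
    in the Q-function.  For [max Q Q'] that instance holds: on sequences of
    length [k + 1], [Q] dominates both [Q] (as it is Bellman-like) and [Q'] (as
    [Q'] lies below the infimum of [Q] over the last input), and [max Q Q']
    dominates [Q]. *)

Require Import Defs.
From HB Require Import structures.
From mathcomp Require Import all_boot all_order all_algebra.
From mathcomp Require Import all_classical all_reals all_analysis.

Set Implicit Arguments.
Unset Strict Implicit.
Unset Printing Implicit Defensive.

Import Order.TTheory.

Local Open Scope ereal_scope.

Section TuplePrefix.
Context {T : Type}.

Lemma tuple_prefix_id (m : nat) (mm : (m <= m)%N) (t : m.-tuple T) :
  tuple_prefix mm t = t.
Proof.
by apply: eq_from_tnth => i; rewrite tnth_mktuple; congr tnth; apply: val_inj.
Qed.

Lemma tuple_prefix_trans (m n l : nat) (mn : (m <= n)%N) (nl : (n <= l)%N)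
    (ml : (m <= l)%N) (t : l.-tuple T) :
  tuple_prefix mn (tuple_prefix nl t) = tuple_prefix ml t.
Proof.
by apply: eq_from_tnth => i; rewrite !tnth_mktuple; congr tnth; apply: val_inj.
Qed.

Lemma thead_tuple_prefix (m l : nat) (ml : (m.+1 <= l.+1)%N)
    (t : l.+1.-tuple T) :
  thead (tuple_prefix ml t) = thead t.
Proof. by rewrite /thead tnth_mktuple; congr tnth; apply: val_inj. Qed.

Lemma behead_tuple_prefix (m l : nat) (ml : (m.+1 <= l.+1)%N) (ml' : (m <= l)%N)
    (t : l.+1.-tuple T) :
  behead_tuple (tuple_prefix ml t) = tuple_prefix ml' (behead_tuple t).
Proof.
apply: eq_from_tnth => i; rewrite tnth_behead !tnth_mktuple tnth_behead.
congr tnth; apply: val_inj => /=.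
(* [tnth_behead] reads its entry through [inord], which is the successor of [i] only within range;
   the longer tuple gets its bound from [ml']. *)
by rewrite !inordK // ltnS ?(leq_trans _ ml').
Qed.

(** Exhibits a sequence of length [m.+1] as a member of the family whose infimum defines
    [bellman_op]. *)
Lemma tuple_prefix_rcons (m : nat) (ml : (m <= m.+1)%N) (t : m.+1.-tuple T) :
  rcons_tuple (tuple_prefix ml t) (tnth t ord_max) = t.
Proof.
apply: eq_from_tnth => i; have x0 := tnth t ord_max.
rewrite (tnth_nth x0) /= nth_rcons size_map size_enum_ord.
have [im|mi] := ltnP i m.
  rewrite -[nat_of_ord i in LHS]/(nat_of_ord (Ordinal im)).
  rewrite -(tnth_nth x0 (tuple_prefix ml t)) tnth_mktuple.
  by congr tnth; apply: val_inj.
have im : i = m :> nat by apply/eqP; rewrite eqn_leq mi -ltnS ltn_ord.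
by rewrite im eqxx; congr tnth; apply: val_inj.
Qed.

End TuplePrefix.

Section BellmanLike.
Context {R : realType} {nx nu : nat} {S : hybrid_system R nx nu}.
Implicit Types (c : cost_function S) (s : state S).

(** Emptiness of the Post set depends on neither function, so the value [+oo] occurs on both sides
    at once. *)
Lemma le_post_max (a : input S) s (f g : state S -> \bar R) :
  (forall s', f s' <= g s') -> post_max a s f <= post_max a s g.
Proof.
move=> fg; rewrite /post_max; case: ifP => // _.
apply: ge_ereal_sup => _ [s' ps' <-]; apply: le_trans (fg s') _.
by apply: ereal_sup_ubound; exists s'.
Qed.

Lemma le_qext c (k : nat) (Q Q' : qfunction S k) (j : nat) s v u :
  (forall s v u, (Q s v u <= Q' s v u)%R) -> qext c Q j s v u <= qext c Q' j s v u.
Proof.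
move=> QQ'; elim: j s v u => [|j IH] s v u /=; first by rewrite lee_fin.
by rewrite leeD2l//; apply: le_post_max.
Qed.

Lemma bellman_like_one_step c (k : nat) (Q : qfunction S k) :
  (forall (ml : (k <= k.+1)%N) s v u,
     (Q s (tuple_prefix ml v) (tuple_prefix ml u))%:E <= qext c Q 1 s v u) ->
  bellman_like c Q.
Proof.
move=> Q1; elim=> [|i IHi] j ml s v u.
  elim: j ml s v u => [|j IHj] ml s v u; first by rewrite !tuple_prefix_id.
  have kSk : (k <= k.+1)%N := leqnSn k.
  have kSjk : (k.+1 <= (j + k).+1)%N by rewrite ltnS leq_addl.
  (* Passing through the prefix of length [k.+1] makes [Q1] applicable; the first inputs then agree,
     and [IHj] compares the tails. *)
  rewrite -(tuple_prefix_trans kSk kSjk ml v) -(tuple_prefix_trans kSk kSjk ml u).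
  apply: le_trans (Q1 kSk s _ _) _ => /=.
  rewrite !thead_tuple_prefix leeD2l//; apply: le_post_max => s'.
  rewrite !(behead_tuple_prefix _ (leq_addl j k)).
  exact: IHj.
(* The longer sequence also exceeds length [k], so both sides peel off the same first input. *)
case: j ml v u => [|j] ml v u; first by exfalso; move: ml; rewrite leq_add2r.
rewrite /= !thead_tuple_prefix leeD2l//; apply: le_post_max => s'.
rewrite !(behead_tuple_prefix _ (ml : (i + k <= j + k)%N)).
exact: IHi.
Qed.

End BellmanLike.

Theorem proposition17 (R : realType) (nx nu : nat)
    (S : hybrid_system R nx nu) (c : cost_function S) (k : nat)
    (Q Q' : qfunction S k) :
  deterministic S ->
  bellman_like c Q ->
  (forall (s : state S) (v : k.-tuple (dinput S)) (u : k.-tuple (cinput S)),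
      (Q' s v u)%:E <= bellman_op c Q s v u) ->
  bellman_like c (qmax Q Q').
Proof.
move=> _ QB Q'T; apply: bellman_like_one_step => ml s v u.
have : qext c Q 1 s v u <= qext c (qmax Q Q') 1 s v u.
  by apply: le_qext => {}s {}v {}u; rewrite /qmax le_max lexx.
apply: le_trans; rewrite /qmax EFin_max ge_max; apply/andP; split.
  exact: (QB 0%N 1%N ml).
apply: le_trans (Q'T _ _ _) _; apply: ereal_inf_lbound.
(* The infimum is bounded by its value at the input actually applied last. *)
exists (tnth v ord_max, tnth u ord_max) => //=.
by rewrite !tuple_prefix_rcons.
Qed.
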